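(* For every colored graph $(\Gamma;\vec{j'})$ there is an isomorphism of groups $$H^1(\Gamma;\vec{j'})\;\cong\;\bigoplus_{[\vec j]\in\overline{QCG_k}(\Gamma;\vec{j'})}H_1(\Gamma)_{\vec j}^*,$$ where $H_1(\Gamma)_{\vec j}:=\{\lambda\in H_1(\Gamma)\mid \lambda\cdot\vec j=\vec j\}$ is the stabilizer of $\vec j$ (which depends only on the orbit $[\vec j]$, since $H_1(\Gamma)$ is abelian) and $(\cdot)^*:=\mathrm{Hom}(\,\cdot\,,R^\times)$ denotes group homomorphisms to $R^\times$.
   Context: Fix a positive integer $k$ (the level) and a commutative ring $R$ with unit; $R^\times$ is its group of units. A unitrivalent graph is a finite graph (loops and multiple edges allowed) all of whose vertices are trivalent or univalent. Let $\Gamma$ be a unitrivalent graph with $3g-3+2n$ edges $\{f_l\}$, $2g-2+n$ trivalent vertices and $n$ univalent vertices $w_1,\dots,w_n$, the edges being numbered so that $f_1,\dots,f_n$ are the edges incident to $w_1,\dots,w_n$. $H_1(\Gamma)$ denotes homology with $\mathbb Z/2$ coefficients, $H_1(\Gamma)\cong(\mathbb Z/2)^g$; an element $\lambda\in H_1(\Gamma)$ is a mod 2 cycle, identified with the set of edges lying on it. A colored graph is a pair $(\Gamma;\vec{j'})$ with $\vec{j'}=(j'_1,\dots,j'_n)\in\{0,\frac12,\dots,\frac k2\}^n$. $QCG_k(\Gamma;\vec{j'})$ is the set of admissible colorings of level $k$: maps $\vec j=(j_l):\{f_l\}\to\{0,\frac12,\dots,\frac k2\}$, $j_l:=\vec j(f_l)$,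 with $j_l=j'_l$ for $l=1,\dots,n$, such that at each trivalent vertex with incident edges $f_{i_1},f_{i_2},f_{i_3}$ one has $j_{i_1}+j_{i_2}+j_{i_3}\in\mathbb Z$, $|j_{i_1}-j_{i_2}|\le j_{i_3}\le j_{i_1}+j_{i_2}$ and $j_{i_1}+j_{i_2}+j_{i_3}\le k$ (for a vertex with a loop, $f_{i_2}=f_{i_3}$ and the conditions are read with $j_{i_2}=j_{i_3}$). $H_1(\Gamma)$ acts on $QCG_k(\Gamma;\vec{j'})$: $\lambda\cdot\vec j$ is obtained from $\vec j$ by replacing $j_l$ with $\frac k2-j_l$ for every edge $f_l$ lying on $\lambda$, and leaving the other entries unchanged. $\overline{QCG_k}(\Gamma;\vec{j'})$ is the set of orbits and $[\vec j]$ the orbit of $\vec j$. Put $A(\Gamma;\vec{j'}):=(R^\times)^{QCG_k(\Gamma;\vec{j'})}$, with $H_1(\Gamma)$-action $\lambda:(c_{\vec j})\mapsto(c_{\lambda\cdot\vec j})$. $H^*(\Gamma;\vec{j'})$ is the group cohomology $H^*(H_1(\Gamma);A(\Gamma;\vec{j'}))$ (coefficients written multiplicatively). Explicitly, a twisted 1-cocycle is a map $\delta=(\delta_{\vec j}):H_1(\Gamma)\to A(\Gamma;\vec{j'})$ with $\delta_{\vec j}(\lambda+\lambda')=\delta_{\lambda\cdot\vec j}(\lambda')\,\delta_{\vec j}(\lambda)$, and a coboundary is one of the form $\delta_{\vec j}(\lambda)=c_{\lambda\cdot\vec j}\,c_{\vec j}^{-1}$ for some $(c_{\vec j})\in A(\Gamma;\vec{j'})$.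 *)

(* Defs.v *)
From HB Require Import structures.
From mathcomp Require Import all_boot all_order all_algebra.
From mathcomp Require Import ring lra boolp.

Set Implicit Arguments.
Unset Strict Implicit.
Unset Printing Implicit Defensive.

Import Order.TTheory GRing.Theory Num.Theory.
Local Open Scope ring_scope.

(* Abelian groups are zmodTypes, hence written additively, including the group
   of units R^* below: its + and 0 are the product and the 1 of R, and - is
   the inverse. *)

Section Units.

Variable R : comPzRingType.

Definition invertible : {pred R} := fun x => `[< exists y, x * y = 1 >].

Record units := Units { uval :> R; _ : uval \in invertible }.

HB.instance Definition _ := [isSub for uval].
HB.instance Definition _ := [Choice of units by <:].

Lemma units_exinv (u : units) : exists y, uval u * y = 1.
Proof. by case: u => x /= /asboolP. Qed.

Definition uinvval (u : units) : R := projT1 (cid (units_exinv u)).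

Lemma uinvvalP (u : units) : uval u * uinvval u = 1.
Proof. by rewrite /uinvval; case: cid. Qed.

Fact uone_subproof : (1 : R) \in invertible.
Proof. by apply/asboolP; exists 1; rewrite mulr1. Qed.

Fact umul_subproof (u v : units) : uval u * uval v \in invertible.
Proof.
apply/asboolP; exists (uinvval u * uinvval v).
by rewrite mulrACA !uinvvalP mulr1.
Qed.

Fact uinv_subproof (u : units) : uinvval u \in invertible.
Proof. by apply/asboolP; exists (uval u); rewrite mulrC uinvvalP. Qed.

Definition uone : units := Units uone_subproof.
Definition umul (u v : units) : units := Units (umul_subproof u v).
Definition uinv (u : units) : units := Units (uinv_subproof u).

Fact umulA : associative umul.
Proof. by move=> u v w; apply: val_inj; rewrite /= mulrA. Qed.

Fact umulC : commutative umul.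
Proof. by move=> u v; apply: val_inj; rewrite /= mulrC. Qed.

Fact umul1 : left_id uone umul.
Proof. by move=> u; apply: val_inj; rewrite /= mul1r. Qed.

Fact umulV : left_inverse uone uinv umul.
Proof. by move=> u; apply: val_inj; rewrite /= mulrC uinvvalP. Qed.

HB.instance Definition _ := GRing.isZmodule.Build units umulA umulC umul1 umulV.

Lemma uvalD (u v : units) : uval (u + v) = uval u * uval v.
Proof. by []. Qed.

End Units.

Section HomGroup.

Variables (S : finZmodType) (M : zmodType).

Definition additiveb : {pred {ffun S -> M}} :=
  fun f => [forall x, forall y, f (x + y) == f x + f y].

Fact additiveb_zmod_closed : zmod_closed additiveb.
Proof.
split=> [|f h /'forall_forallP-fP /'forall_forallP-hP].
  by apply/'forall_forallP => x y; rewrite !ffunE addr0.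
apply/'forall_forallP => x y; rewrite !ffunE (eqP (fP x y)) (eqP (hP x y)).
by rewrite opprD addrACA.
Qed.

HB.instance Definition _ :=
  GRing.isZmodClosed.Build _ additiveb additiveb_zmod_closed.

Record homgroup := MkHomgroup { hom_fun :> {ffun S -> M}; _ : hom_fun \in additiveb }.

HB.instance Definition _ := [isSub for hom_fun].
HB.instance Definition _ := [Choice of homgroup by <:].
HB.instance Definition _ := [SubChoice_isSubZmodule of homgroup by <:].

End HomGroup.

Section DirectSum.

Variables (I : finType) (V : I -> zmodType).

(* The index type is finite, so that the direct sum is the product. *)
Definition dsum := {dffun forall i : I, V i}.

HB.instance Definition _ := Choice.on dsum.

Definition dsum_zero : dsum := [ffun i => 0 : V i].
Definition dsum_opp (f : dsum) : dsum := [ffun i => - f i].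
Definition dsum_add (f h : dsum) : dsum := [ffun i => f i + h i].

Fact dsum_addA : associative dsum_add.
Proof. by move=> a b c; apply/ffunP => i; rewrite !ffunE addrA. Qed.

Fact dsum_addC : commutative dsum_add.
Proof. by move=> a b; apply/ffunP => i; rewrite !ffunE addrC. Qed.

Fact dsum_add0 : left_id dsum_zero dsum_add.
Proof. by move=> a; apply/ffunP => i; rewrite !ffunE add0r. Qed.

Fact dsum_addN : left_inverse dsum_zero dsum_opp dsum_add.
Proof. by move=> a; apply/ffunP => i; rewrite !ffunE addNr. Qed.

HB.instance Definition _ :=
  GRing.isZmodule.Build dsum dsum_addA dsum_addC dsum_add0 dsum_addN.

End DirectSum.

Record zaction (H : zmodType) (X : Type) := ZAction {
  zact :> H -> X -> X;
  zact0 : forall x, zact 0 x = x;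
  zactD : forall a b x, zact (a + b) x = zact b (zact a x)
}.

Section OrbitsAndStabilizers.

Variables (H : finZmodType) (X : finType) (to : zaction H X).

Definition zorbit (x : X) : {set X} := [set to a x | a : H].

Definition orbits := {O : {set X} | [exists x, O == zorbit x]}.

Definition orbit_rep (O : orbits) : X := xchoose (existsP (valP O)).

Definition stabb (x : X) : {pred H} := fun a => to a x == x.

Fact stabb_zmod_closed x : zmod_closed (stabb x).
Proof.
split=> [|a b /eqP ax /eqP bx]; first by apply/eqP; exact: zact0.
by apply/eqP; rewrite zactD ax -{1}bx -zactD subrr zact0.
Qed.

HB.instance Definition _ x :=
  GRing.isZmodClosed.Build H (stabb x) (stabb_zmod_closed x).

Record stabilizer (x : X) :=
  MkStabilizer { stab_val :> H; _ : stab_val \in stabb x }.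

HB.instance Definition _ x := [isSub for @stab_val x].
HB.instance Definition _ x := [Finite of stabilizer x by <:].
HB.instance Definition _ x := [SubChoice_isSubZmodule of stabilizer x by <:].

End OrbitsAndStabilizers.

(* First cohomology of H with coefficients in the H-module of functions from X
   to M, where a in H sends c to x |-> c (to a x). *)
Section FirstCohomology.

Variables (H : finZmodType) (X : finType) (to : zaction H X) (M : zmodType).

Definition cochain1 := {ffun H -> {ffun X -> M}}.

Definition cocycleb : {pred cochain1} :=
  fun d => [forall a, forall b, [forall x, d (a + b) x == d b (to a x) + d a x]].

Fact cocycleb_zmod_closed : zmod_closed cocycleb.
Proof.
split=> [|d e /'forall_'forall_forallP-dP /'forall_'forall_forallP-eP].
  by apply/'forall_'forall_forallP => a b x; rewrite !ffunE addr0.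
apply/'forall_'forall_forallP => a b x.
by rewrite !ffunE (eqP (dP a b x)) (eqP (eP a b x)) opprD addrACA.
Qed.

HB.instance Definition _ :=
  GRing.isZmodClosed.Build _ cocycleb cocycleb_zmod_closed.

Record cocycle1 :=
  MkCocycle1 { cocycle_val :> cochain1; _ : cocycle_val \in cocycleb }.

HB.instance Definition _ := [isSub for cocycle_val].
HB.instance Definition _ := [Choice of cocycle1 by <:].
HB.instance Definition _ := [SubChoice_isSubZmodule of cocycle1 by <:].

Definition coboundaryb : {pred cocycle1} := fun d =>
  `[< exists c : {ffun X -> M}, forall a x, (d : cochain1) a x = c (to a x) - c x >].

Fact coboundaryb_zmod_closed : zmod_closed coboundaryb.
Proof.
split=> [|d e /asboolP[c dE] /asboolP[c' eE]]; apply/asboolP.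
  by exists 0 => a x; rewrite !ffunE subrr.
exists (c - c') => a x.
have -> : cocycle_val (d - e) = cocycle_val d - cocycle_val e by [].
rewrite !ffunE dE eE.
by rewrite !opprD !opprK addrACA.
Qed.

HB.instance Definition _ :=
  GRing.isZmodClosed.Build _ coboundaryb coboundaryb_zmod_closed.

Definition cohomology1 : zmodType := Quotient.quot coboundaryb.

End FirstCohomology.

(* A half-edge is a pair (l, b): the edge l joins the vertices endpt (l, false)
   and endpt (l, true), which are equal for a loop. *)
Record multigraph := MultiGraph {
  vertex : finType;
  nedges : nat;
  endpt : 'I_nedges * bool -> vertex
}.

Section CycleSpace.

Variable G : multigraph.

Notation edge := 'I_(nedges G).

Definition degree (v : vertex G) : nat := #|[set h | endpt h == v]|.

Definition boundary (c : {ffun edge -> 'F_2}) : {ffun vertex G -> 'F_2} :=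
  [ffun v => \sum_(h | endpt h == v) c h.1].

Definition cycleb : {pred {ffun edge -> 'F_2}} := fun c => boundary c == 0.

Fact cycleb_zmod_closed : zmod_closed cycleb.
Proof.
split=> [|c d /eqP cP /eqP dP]; apply/eqP/ffunP => v; rewrite !ffunE.
  by rewrite big1 // => h _; rewrite ffunE.
move/ffunP/(_ v): cP; move/ffunP/(_ v): dP; rewrite !ffunE => dP cP.
rewrite (eq_bigr (fun h => c h.1 - d h.1)); last by move=> h _; rewrite !ffunE.
by rewrite sumrB cP dP subrr.
Qed.

HB.instance Definition _ :=
  GRing.isZmodClosed.Build _ cycleb cycleb_zmod_closed.

(* There are no 2-cells: H_1 is the group of 1-cycles. *)
Record H1 := MkH1 { chain :> {ffun edge -> 'F_2}; _ : chain \in cycleb }.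

HB.instance Definition _ := [isSub for chain].
HB.instance Definition _ := [Finite of H1 by <:].
HB.instance Definition _ := [SubChoice_isSubZmodule of H1 by <:].

Definition lies_on (l : edge) (c : H1) : bool := c l != 0.

End CycleSpace.

(* The i-th univalent vertex is incident to the edge with the same index; the
   truncated subtractions in 3g-3+2n and 2g-2+n are avoided by adding. *)
Record unitrivalent_graph (g n : nat) := UnitrivalentGraph {
  ugraph :> multigraph;
  leaf : 'I_n -> vertex ugraph;
  leaf_inj : injective leaf;
  degree_leaf : forall v, degree v = 1%N <-> exists i, v = leaf i;
  degree_1_or_3 : forall v : vertex ugraph, degree v = 1%N \/ degree v = 3%N;
  num_trivalent :
    (#|[set v : vertex ugraph | degree v == 3%N]| + 2 = 2 * g + n)%N;
  num_edges : (nedges ugraph + 3 = 3 * g + 2 * n)%N;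
  leaf_edge : forall i : 'I_n,
    exists h, endpt h = leaf i /\ h.1 = i :> nat;
  H1_rank : exists f : {additive H1 ugraph -> 'rV['F_2]_g}, bijective f
}.

Section Colorings.

Variables (k g n : nat) (G : unitrivalent_graph g n) (j' : 'I_n -> 'I_k.+1).

Notation edge := 'I_(nedges G).

(* The index a : 'I_k.+1 stands for the color a/2, so that rev_ord a stands
   for k/2 - a/2. *)
Definition color_val (a : 'I_k.+1) : rat := a%:R / 2.

Definition vertex_cond (a b c : 'I_k.+1) : bool :=
  let x := color_val a in let y := color_val b in let z := color_val c in
  [&& x + y + z \is a Num.int, `|x - y| <= z <= x + y & x + y + z <= k%:R].

(* Only a trivalent vertex carries three distinct half-edges. *)
Definition admissible : {pred {ffun edge -> 'I_k.+1}} := fun j =>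
  [forall l : edge, forall i : 'I_n, (l == i :> nat) ==> (j l == j' i)] &&
  [forall h1 : edge * bool, forall h2 : edge * bool, forall h3 : edge * bool,
    [&& uniq [:: h1; h2; h3], endpt h1 == endpt h2 & endpt h2 == endpt h3] ==>
    vertex_cond (j h1.1) (j h2.1) (j h3.1)].

Record QCG := MkQCG {
  coloring :> {ffun edge -> 'I_k.+1};
  _ : coloring \in admissible
}.

HB.instance Definition _ := [isSub for coloring].
HB.instance Definition _ := [Finite of QCG by <:].

Definition flip (c : H1 G) (j : {ffun edge -> 'I_k.+1}) :
    {ffun edge -> 'I_k.+1} :=
  [ffun l => if lies_on l c then rev_ord (j l) else j l].

Lemma F2P (x : 'F_2) : x = 0 \/ x = 1.
Proof. by case: x => [[|[|[]]] //= lt]; [left | right]; apply: val_inj. Qed.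

Lemma lies_onD (l : edge) (c d : H1 G) :
  lies_on l (c + d) = lies_on l c (+) lies_on l d.
Proof.
rewrite /lies_on; have -> : chain (c + d) = chain c + chain d by [].
rewrite ffunE.
by case: (F2P (c l)) => ->; case: (F2P (d l)) => ->.
Qed.

Lemma flip0 (j : {ffun edge -> 'I_k.+1}) : flip 0 j = j.
Proof. by apply/ffunP => l; rewrite !ffunE /lies_on /= ffunE eqxx. Qed.

Lemma flipD (c d : H1 G) (j : {ffun edge -> 'I_k.+1}) :
  flip (c + d) j = flip d (flip c j).
Proof.
apply/ffunP => l; rewrite !ffunE lies_onD.
by case: (lies_on l c); case: (lies_on l d); rewrite //= rev_ordK.
Qed.

Lemma cycle_vertex (c : H1 G) (v : vertex G) :
  \sum_(h | endpt h == v) c h.1 = 0.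
Proof. by case: c => c /= /eqP/ffunP/(_ v); rewrite !ffunE. Qed.

Lemma cycle_leaf (c : H1 G) (l : edge) (i : 'I_n) :
  l = i :> nat -> ~~ lies_on l c.
Proof.
move=> li; have [h [hv hi]] := leaf_edge G i.
have dv : degree (leaf G i) = 1%N by apply/degree_leaf; exists i.
have /cards1P[h' hE] : #|[set h | endpt h == leaf G i]| == 1%N by apply/eqP.
have hh : h = h'.
  have : h \in [set h0 | endpt h0 == leaf G i] by rewrite inE hv.
  by rewrite hE => /set1P.
have := cycle_vertex c (leaf G i).
rewrite (eq_bigl (pred1 h)); last first.
  by move=> h0; have /setP/(_ h0) := hE; rewrite !inE hh.
rewrite big_pred1_eq /lies_on => ch.
by have -> : l = h.1 by [apply: val_inj; rewrite /= li hi]; rewrite ch eqxx.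
Qed.

Lemma cycle_trivalent (c : H1 G) (h1 h2 h3 : edge * bool) :
  uniq [:: h1; h2; h3] -> endpt h1 = endpt h2 -> endpt h2 = endpt h3 ->
  lies_on h1.1 c (+) lies_on h2.1 c (+) lies_on h3.1 c = false.
Proof.
move=> hu e12 e23; set v := endpt h2.
have sub : [set h in [:: h1; h2; h3]] \subset [set h | endpt h == v].
  apply/subsetP => h; rewrite !inE => /or3P[] /eqP ->;
  by rewrite /v ?e12 -?e23.
have cs : #|[set h in [:: h1; h2; h3]]| = 3%N.
  by rewrite cardsE; apply/card_uniqP.
have dv : degree v = 3%N.
  have := subset_leq_card sub; rewrite cs -/(degree v).
  by case: (degree_1_or_3 v) => ->.
have setE : [set h in [:: h1; h2; h3]] = [set h | endpt h == v].
  by apply/eqP; rewrite eqEcard sub cs -/(degree v) dv.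
have := cycle_vertex c v.
rewrite (eq_bigl (mem [:: h1; h2; h3])); last first.
  by move=> h; have /setP/(_ h) := setE; rewrite !inE => ->.
rewrite -big_uniq // !big_cons big_nil /= addr0 /lies_on.
by case: (F2P (c h1.1)) => ->; case: (F2P (c h2.1)) => ->;
  case: (F2P (c h3.1)) => ->.
Qed.

Lemma color_val_rev (a : 'I_k.+1) :
  color_val (rev_ord a) = k%:R / 2 - color_val a.
Proof. by rewrite /color_val /= subSS natrB -1?ltnS // mulrBl. Qed.

Lemma vertex_condC12 a b c : vertex_cond a b c = vertex_cond b a c.
Proof.
rewrite /vertex_cond.
by rewrite [color_val b + _]addrC [`|color_val b - _|]distrC.
Qed.

Lemma vertex_condC23 a b c : vertex_cond a b c = vertex_cond a c b.
Proof.
rewrite /vertex_cond; rewrite [color_val a + color_val c + _]addrAC.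
congr [&& _, _ & _].
by rewrite !ler_norml; apply/andP/andP => -[/andP[? ?] ?]; do ?split; lra.
Qed.

Lemma vertex_cond_rev a b c :
  vertex_cond a b c -> vertex_cond (rev_ord a) (rev_ord b) c.
Proof.
rewrite /vertex_cond !color_val_rev => /and3P[hI h1 h2]; apply/and3P; split.
- have -> : k%:R / 2 - color_val a + (k%:R / 2 - color_val b) + color_val c
    = k%:R + c%:R - (color_val a + color_val b + color_val c).
    by rewrite /color_val; field.
  by rewrite rpredB // rpredD // rpred_nat.
- move: h1; rewrite !ler_norml => /andP[/andP[? ?] ?].
  by apply/andP; split; [apply/andP; split|]; lra.
- by move: h1 => /andP[_ ?]; lra.
Qed.

Lemma flip_admissible (c : H1 G) (j : {ffun edge -> 'I_k.+1}) :
  j \in admissible -> flip c j \in admissible.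
Proof.
case/andP => /'forall_forallP hl /forallP hv; apply/andP; split.
  apply/'forall_forallP => l i; apply/implyP => li.
  rewrite ffunE (negPf (cycle_leaf c (eqP li))).
  exact: (implyP (hl l i)).
apply/forallP => h1; apply/forallP => h2; apply/forallP => h3.
apply/implyP => /and3P[hu /eqP e12 /eqP e23].
have := hv h1 => /forallP/(_ h2)/forallP/(_ h3); rewrite hu e12 e23 !eqxx /=.
have := cycle_trivalent c hu e12 e23; rewrite !ffunE.
case: (lies_on h1.1 c); case: (lies_on h2.1 c); case: (lies_on h3.1 c) => //= _.
- exact: vertex_cond_rev.
- by rewrite vertex_condC23 => /vertex_cond_rev; rewrite vertex_condC23.
rewrite vertex_condC12 vertex_condC23 => /vertex_cond_rev.
by rewrite vertex_condC23 vertex_condC12.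
Qed.

Definition flipQCG (c : H1 G) (j : QCG) : QCG :=
  MkQCG (flip_admissible c (valP j)).

Fact flipQCG0 (j : QCG) : flipQCG 0 j = j.
Proof. by apply: val_inj; exact: flip0. Qed.

Fact flipQCGD (c d : H1 G) (j : QCG) :
  flipQCG (c + d) j = flipQCG d (flipQCG c j).
Proof. by apply: val_inj; exact: flipD. Qed.

Definition QCG_action : zaction (H1 G) QCG := ZAction flipQCG0 flipQCGD.

End Colorings.

(* Main.v *)
Require Import Defs.
From HB Require Import structures.
From mathcomp Require Import all_boot all_order all_algebra.
From mathcomp Require Import boolp.

Set Implicit Arguments.
Unset Strict Implicit.
Unset Printing Implicit Defensive.

Import GRing.Theory.
Local Open Scope ring_scope.
Local Open Scope quotient_scope.

(** The theorem is an instance of a fact about every finite abelian group H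
    acting on a finite set X and every abelian group M of coefficients.  As an
    H-module, M^X is the product over the orbits O of the modules M^O, each of
    them coinduced from the trivial module M of the stabilizer of a point of O,
    so that this is Shapiro's lemma in degree 1; the argument below makes both
    directions explicit.

    Choose a representative r in each orbit.  On the stabilizer of r the
    cocycle identity at r reads d(s + t)(r) = d(t)(r) + d(s)(r), hence
    restricting a cocycle to the stabilizers of the representatives gives
    homomorphisms ([restriction]).  Coboundaries restrict to 0.  Conversely, if
    the restriction of d vanishes, then d(u)(r) depends only on the point u.r,
    hence c(u.r) := d(u)(r) is a well defined function on X, and the cocycle
    identity says that d is the coboundary of c
    ([coboundary_restriction_eq0]).

    For surjectivity, choose for each x an element t(x) of H moving the
    representative r of its orbit to x.  The element t(x) + a - t(a.x) fixes r
    and, as a function of (a, x), satisfies the cocycle identity in H because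
    the sum telescopes; applying given homomorphisms to it yields a cocycle
    ([extension]).  It restricts to the given homomorphisms, since for a in the
    stabilizer of r the two translations t(r) cancel, H being abelian
    ([extensionK]). *)

(** * Homomorphisms out of a quotient group *)

(** First isomorphism theorem, with surjectivity witnessed by a section of F;
    the inverse sends w to the class of S w. *)
Lemma quot_iso_of_section (V W : zmodType) (I : zmodClosed V) (F : V -> W)
    (S : W -> V) :
  {morph F : u v / u + v} -> (forall v, (v \in I) = (F v == 0)) ->
  cancel S F ->
  exists f : {additive Quotient.quot I -> W}, bijective f.
Proof.
move=> FD kerF SK; set Q := Quotient.quot I.
have FB u v : F (u - v) = F u - F v.
  by apply: (addIr (F v)); rewrite -FD !subrK.
have Feq u v : (F u == F v) = (u == v %[mod Q]).
  by rewrite -Quotient.idealrBE kerF FB subr_eq0.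
pose f (q : Q) := F (repr q).
have fpi v : f (\pi v) = F v by apply/eqP; rewrite Feq reprK.
have f_zmod : zmod_morphism f.
  move=> p q; rewrite -[p]reprK -[q]reprK.
  have -> : \pi_Q (repr p) - \pi_Q (repr q) = \pi_Q (repr p - repr q).
    by rewrite !piE.
  by rewrite !fpi FB.
pose fA := GRing.isZmodMorphism.Build _ _ f f_zmod.
pose fM : {additive Q -> W} := HB.pack f fA.
exists fM, (fun w => \pi_Q (S w)) => [q|w]; last by rewrite /= fpi SK.
by rewrite -[RHS]reprK; apply/eqP; rewrite -Feq SK.
Qed.

(** * Transporters *)

Section Transporters.

Variables (H : finZmodType) (X : finType) (to : zaction H X).

Lemma zactNK a x : to (- a) (to a x) = x.
Proof. by rewrite -zactD subrr zact0. Qed.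

Lemma zorbit_zact a x : zorbit to (to a x) = zorbit to x.
Proof.
apply/setP=> y; apply/imsetP/imsetP=> -[b _ ->].
  by exists (a + b); rewrite ?zactD.
by exists (b - a); rewrite // [b - a]addrC zactD zactNK.
Qed.

Fact orbit_of_subproof x : [exists y, zorbit to x == zorbit to y].
Proof. by apply/existsP; exists x. Qed.

Definition orbit_of x : orbits to := exist _ (zorbit to x) (orbit_of_subproof x).

Lemma orbit_of_zact a x : orbit_of (to a x) = orbit_of x.
Proof. by apply: val_inj; rewrite /= zorbit_zact. Qed.

Lemma zorbit_rep (O : orbits to) : zorbit to (orbit_rep O) = val O.
Proof. by apply/esym/eqP/(xchooseP (existsP (valP O))). Qed.

Lemma orbit_of_rep (O : orbits to) : orbit_of (orbit_rep O) = O.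
Proof. by apply: val_inj; rewrite /= zorbit_rep. Qed.

Lemma transporter_exists x : exists a, to a (orbit_rep (orbit_of x)) == x.
Proof.
have : x \in zorbit to (orbit_rep (orbit_of x)).
  by rewrite zorbit_rep; apply/imsetP; exists 0; rewrite ?zact0.
by case/imsetP=> a _ xE; exists a; rewrite -xE.
Qed.

Definition transporter x : H := xchoose (transporter_exists x).

Lemma transporterP x : to (transporter x) (orbit_rep (orbit_of x)) = x.
Proof. exact/eqP/(xchooseP (transporter_exists x)). Qed.

(** The failure of [transporter] to be equivariant.  It is the universal
    cocycle: its values lie in the stabilizers, and every cocycle is, up to a
    coboundary, its image under homomorphisms on the stabilizers. *)
Definition defect a x : H := transporter x + a - transporter (to a x).

Lemma defect_stab a x : defect a x \in stabb to (orbit_rep (orbit_of x)).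
Proof.
apply/eqP; rewrite !zactD transporterP.
by rewrite -{2}[to a x]transporterP orbit_of_zact zactNK.
Qed.

Lemma defectD a b x : defect (a + b) x = defect b (to a x) + defect a x.
Proof.
by rewrite /defect zactD [RHS]addrC !addrA subrK.
Qed.

Lemma defect_fixed a x : a \in stabb to x -> defect a x = a.
Proof. by move=> /eqP ax; rewrite /defect ax addrC addKr. Qed.

End Transporters.

(** * Restriction of cocycles to stabilizers *)

Section Restriction.

Variables (H : finZmodType) (X : finType) (to : zaction H X) (M : zmodType).

Implicit Types (d : cocycle1 to M) (O : orbits to).

Notation hom_at O := (homgroup (stabilizer to (orbit_rep O)) M).
Notation homs := (dsum (fun O => hom_at O)).

Lemma cocycleE d a b x : cocycle_val d (a + b) x =
  cocycle_val d b (to a x) + cocycle_val d a x.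
Proof. by case: d => d /= /'forall_'forall_forallP/(_ a b x)/eqP. Qed.

Fact restr_subproof d x :
  [ffun s : stabilizer to x => cocycle_val d (stab_val s) x] \in @additiveb _ M.
Proof.
apply/'forall_forallP=> s t; rewrite !ffunE.
have -> : stab_val (s + t) = stab_val s + stab_val t by [].
by rewrite cocycleE (eqP (valP s)) addrC.
Qed.

Definition restriction d : homs :=
  [ffun O => MkHomgroup (restr_subproof d (orbit_rep O))].

Lemma restrictionE d O s :
  hom_fun (restriction d O) s = cocycle_val d (stab_val s) (orbit_rep O).
Proof. by rewrite ffunE /= ffunE. Qed.

Lemma restrictionD : {morph restriction : d e / d + e}.
Proof.
move=> d e; apply/ffunP=> O; rewrite [RHS]ffunE; apply: val_inj.
have -> : val (restriction d O + restriction e O) =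
  val (restriction d O) + val (restriction e O) by [].
apply/ffunP=> s; rewrite [RHS]ffunE !restrictionE.
have -> : cocycle_val (d + e) = cocycle_val d + cocycle_val e by [].
by rewrite !ffunE.
Qed.

Lemma restriction_eq0P d : reflect
  (forall O a, a \in stabb to (orbit_rep O) -> cocycle_val d a (orbit_rep O) = 0)
  (restriction d == 0).
Proof.
apply: (iffP eqP) => [d0 O a aO|d0].
  rewrite -(restrictionE d (MkStabilizer aO)) d0 ffunE.
  by rewrite -[LHS]/((0 : {ffun _ -> M}) _) ffunE.
apply/ffunP=> O; rewrite [RHS]ffunE; apply/val_inj/ffunP=> s.
rewrite [LHS]restrictionE d0 ?(valP s) //.
by rewrite -[RHS]/((0 : {ffun _ -> M}) _) ffunE.
Qed.

(** The two values differ by d(u - v)(r), and u - v fixes r; this makes the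
    primitive of d in [coboundary_restriction_eq0] independent of the chosen
    transporters. *)
Lemma cocycle_eq_on_fiber d r u v :
  (forall a, a \in stabb to r -> cocycle_val d a r = 0) ->
  to u r = to v r -> cocycle_val d u r = cocycle_val d v r.
Proof.
move=> d0 uv.
have uvr : u - v \in stabb to r by apply/eqP; rewrite zactD uv zactNK.
by rewrite -[u](subrK v) cocycleE d0 // addr0 (eqP uvr).
Qed.

(** A primitive of d is obtained by transporting d from the representatives. *)
Lemma coboundary_restriction_eq0 d :
  (d \in @coboundaryb _ _ to M) = (restriction d == 0).
Proof.
apply/asboolP/restriction_eq0P => [[c dE] O a /eqP aO|d0].
  by rewrite dE aO subrr.
pose rep x := orbit_rep (orbit_of to x).
exists [ffun x => cocycle_val d (transporter to x) (rep x)] => a x.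
rewrite !ffunE /rep orbit_of_zact.
(* Both t(a.x) and t(x) + a move the representative to a.x. *)
rewrite (@cocycle_eq_on_fiber _ _ (transporter to (to a x)) (transporter to x + a)).
- by rewrite cocycleE transporterP addrK.
- exact: d0.
- by rewrite zactD transporterP -(orbit_of_zact to a) transporterP.
Qed.

(** * Extension of homomorphisms to cocycles *)

Lemma homD (S : finZmodType) (h : homgroup S M) s t : h (s + t) = h s + h t.
Proof. by case: h => h /= /'forall_forallP/(_ s t)/eqP. Qed.

(** Extending by 0 to all of H frees the argument from the orbit on which its
    stabilizer depends, so that equal orbits can be rewritten. *)
Definition hom_ext (h : homs) O (a : H) : M :=
  if insub a is Some s then hom_fun (h O) s else 0.

Lemma hom_extE h O (s : stabilizer to (orbit_rep O)) :
  hom_ext h O (val s) = hom_fun (h O) s.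
Proof. by rewrite /hom_ext valK. Qed.

Lemma hom_extD h O a b :
    a \in stabb to (orbit_rep O) -> b \in stabb to (orbit_rep O) ->
  hom_ext h O (a + b) = hom_ext h O a + hom_ext h O b.
Proof.
move=> aO bO; set s := MkStabilizer aO; set t := MkStabilizer bO.
by rewrite -[a + b]/(val (s + t)) -[a]/(val s) -[b]/(val t) !hom_extE homD.
Qed.

Fact extension_subproof (h : homs) :
  [ffun a => [ffun x => hom_ext h (orbit_of to x) (defect to a x)]]
    \in @cocycleb _ _ to M.
Proof.
apply/'forall_'forall_forallP=> a b x; apply/eqP; rewrite !ffunE defectD.
rewrite orbit_of_zact hom_extD ?defect_stab //.
by rewrite -(orbit_of_zact to a) defect_stab.
Qed.

Definition extension (h : homs) : cocycle1 to M :=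
  MkCocycle1 (extension_subproof h).

Lemma extensionK : cancel extension restriction.
Proof.
move=> h; apply/ffunP=> O; apply/val_inj/ffunP=> s.
rewrite [LHS]restrictionE !ffunE orbit_of_rep defect_fixed ?(valP s) //.
exact: hom_extE.
Qed.

(** Shapiro's lemma in degree 1 for a permutation module. *)
Theorem cohomology1_permutation_module :
  exists f : {additive cohomology1 to M -> homs}, bijective f.
Proof.
exact: (quot_iso_of_section restrictionD coboundary_restriction_eq0 extensionK).
Qed.

End Restriction.

(** * Admissible colorings *)

Theorem theorem3p1 (k : nat) (k_gt0 : (0 < k)%N) (R : comPzRingType) (g n : nat)
    (G : unitrivalent_graph g n) (j' : 'I_n -> 'I_k.+1) :
  exists f : {additive cohomology1 (QCG_action G j') (units R) ->
      dsum (fun O : orbits (QCG_action G j') =>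
        homgroup (stabilizer (QCG_action G j') (orbit_rep O)) (units R))},
    bijective f.
Proof. exact: cohomology1_permutation_module. Qed.
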